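(* Let $v$ be a positive integer and $e$ an integer with $0\le e\le\binom v2$. Let $k,j,k',j'$ be the unique integers with $e=\binom{k+1}{2}-j$, $1\le j\le k$, and $e=\binom v2-\binom{k'+1}2+j'$, $1\le j'\le k'$. Then every optimal partition $\pi\in\mathrm{Dis}(v,e)$ is one of the following six partitions: (1.1) $\pi_{1.1}=(v-1,v-2,\dots,k'+1,j')$; (1.2) $\pi_{1.2}=(v-1,v-2,\dots,\widehat{2k'-j'-1},\dots,k'-1)$ (all integers from $v-1$ down to $k'-1$ except $2k'-j'-1$), if $k'+1\le 2k'-j'-1\le v-1$; (1.3) $\pi_{1.3}=(v-1,v-2,\dots,k'+1,2,1)$, if $j'=3$ and $v\ge 4$; (2.1) $\pi_{2.1}=(k,k-1,\dots,\widehat{j},\dots,2,1)$ (all integers from $k$ down to $1$ except $j$); (2.2) $\pi_{2.2}=(2k-j-1,k-2,k-3,\dots,2,1)$, if $k+1\le 2k-j-1\le v-1$; (2.3) $\pi_{2.3}=(k,k-1,\dots,3)$, if $j=3$ and $v\ge 4$. Moreover, $\pi_{1.1}$ and $\pi_{2.1}$ always exist and at least one of them is optimal. The partitions $\pi_{1.2}$ and $\pi_{1.3}$ (when they exist) have the same diagonal sequence as $\pi_{1.1}$, and if $S(v,e)\ge C(v,e)$ then they are all optimal. Similarly $\pi_{2.2}$ and $\pi_{2.3}$ (when they exist) have the same diagonal sequence as $\pi_{2.1}$, and if $S(v,e)\le C(v,e)$ then they are all optimal.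
   Context: $\mathcal G(v,e)$ is the set of simple graphs with $v$ vertices and $e$ edges; $P_2(G)=\sum_i d_i^2$ for a graph with degrees $d_1,\dots,d_v$. $\mathrm{Dis}(v,e)$ is the set of partitions $\pi=(a_0,\dots,a_p)$ of $e$ into distinct parts with $v>a_0>\dots>a_p>0$. The threshold graph $\mathrm{Th}(\pi)$ has vertex set $\{0,\dots,v-1\}$ and, for each $s=0,\dots,p$, edges $\{s,s+1\},\dots,\{s,s+a_s\}$; it lies in $\mathcal G(v,e)$. A partition $\pi\in\mathrm{Dis}(v,e)$ is optimal if $P_2(\mathrm{Th}(\pi))$ is the maximum of $P_2$ over $\mathcal G(v,e)$. The diagonal sequence of $\pi$ is $(\delta_1,\dots,\delta_T)$ where $\delta_i$ is the number of pairs $(s,t)$ with $0\le s\le p$, $s+1\le t\le s+a_s$, $s+t=i$, and $T$ is the largest such $s+t$. $C(v,e)=P_2(\mathrm{Th}(\pi_{2.1}))$ (the quasi-complete graph) and $S(v,e)=P_2(\mathrm{Th}(\pi_{1.1}))$ (the quasi-star graph).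
   Formalization: For e=0 one has k'=j'=v, and the formula for π_{1.1} would give (v), which is not a partition of 0; the formal statement takes π_{1.1} to be the empty partition in this case. *)

(* Defs.v *)
From mathcomp Require Import all_boot.

Set Implicit Arguments.
Unset Strict Implicit.
Unset Printing Implicit Defensive.

(* A simple graph on the vertices 0, ..., v-1 is given by its set of edges,
   each edge being a two-element set of vertices. *)
Definition graphs (v e : nat) : {set {set {set 'I_v}}} :=
  [set E : {set {set 'I_v}} | [forall A in E, #|A| == 2] & #|E| == e].

Definition degree (v : nat) (E : {set {set 'I_v}}) (i : 'I_v) : nat :=
  #|[set A in E | i \in A]|.

Definition P2 (v : nat) (E : {set {set 'I_v}}) : nat :=
  \sum_(i < v) degree E i ^ 2.

(* [path gtn v pi] unfolds to v > a_0 > ... > a_p.  The empty partition is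
   allowed; it is the only element for e = 0. *)
Definition is_Dis (v e : nat) (pi : seq nat) : bool :=
  [&& path gtn v pi, 0 \notin pi & sumn pi == e].

(* The pairs (s, t) with 0 <= s <= p and s + 1 <= t <= s + a_s. *)
Definition cells (pi : seq nat) : seq (nat * nat) :=
  [seq (s, t) | s <- iota 0 (size pi), t <- iota s.+1 (nth 0 pi s)].

Definition Th (v : nat) (pi : seq nat) : {set {set 'I_v}} :=
  [set [set st.1; st.2] | st : 'I_v * 'I_v
                        & (val st.1, val st.2) \in cells pi].

Definition optimal (v e : nat) (pi : seq nat) : Prop :=
  is_Dis v e pi /\ P2 (Th v pi) = \max_(E in graphs v e) P2 E.

Definition delta (pi : seq nat) (i : nat) : nat :=
  count (fun st => st.1 + st.2 == i) (cells pi).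

(* (delta_1, ..., delta_T), with T = 0 for the empty partition. *)
Definition diagonal_sequence (pi : seq nat) : seq nat :=
  [seq delta pi i | i <- iota 1 (\max_(st <- cells pi) (st.1 + st.2))].

(* e = 'C(k + 1, 2) - j, without subtraction. *)
Definition qc_params (e k j : nat) : Prop :=
  1 <= j <= k /\ e + j = 'C(k.+1, 2).

(* e = 'C(v, 2) - 'C(k' + 1, 2) + j', without subtraction. *)
Definition qs_params (v e k' j' : nat) : Prop :=
  1 <= j' <= k' /\ e + 'C(k'.+1, 2) = 'C(v, 2) + j'.

(* All integers from hi down to lo; empty if hi < lo. *)
Definition down (hi lo : nat) : seq nat := rev (iota lo (hi.+1 - lo)).

(* In the definitions below, nat subtraction is never truncated when
   1 <= j' <= k' (resp. 1 <= j <= k) and the existence condition, if any,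
   holds. *)

(* k' = v happens exactly when e = 0 (then j' = v as well).  The formula
   (v-1, ..., k'+1, j') would then be (v), which is not a partition of 0; the
   quasi-star graph without edges is given by the empty partition. *)
Definition pi11 (v k' j' : nat) : seq nat :=
  if k' == v then [::] else rcons (down (v - 1) (k' + 1)) j'.

Definition pi12 (v k' j' : nat) : seq nat :=
  [seq a <- down (v - 1) (k' - 1) | a != 2 * k' - j' - 1].
Definition pi12_exists (v k' j' : nat) : bool :=
  k' + 1 <= 2 * k' - j' - 1 <= v - 1.

Definition pi13 (v k' : nat) : seq nat :=
  down (v - 1) (k' + 1) ++ [:: 2; 1].
Definition pi13_exists (v j' : nat) : bool := (j' == 3) && (4 <= v).

Definition pi21 (k j : nat) : seq nat := [seq a <- down k 1 | a != j].

Definition pi22 (k j : nat) : seq nat := (2 * k - j - 1) :: down (k - 2) 1.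
Definition pi22_exists (v k j : nat) : bool :=
  k + 1 <= 2 * k - j - 1 <= v - 1.

Definition pi23 (k : nat) : seq nat := down k 3.
Definition pi23_exists (v j : nat) : bool := (j == 3) && (4 <= v).

(* C(v, e) and S(v, e); e enters through its parameters k, j, resp. k', j'. *)
Definition quasi_complete_P2 (v k j : nat) : nat := P2 (Th v (pi21 k j)).
Definition quasi_star_P2 (v k' j' : nat) : nat := P2 (Th v (pi11 v k' j')).

(* Main.v *)
(* Writing weight p for the sum of s + t over the cells (s, t) of p, a threshold
   graph satisfies P2 (Th p) = 2 weight p, and a graph of maximal P2 becomes a
   threshold graph once its vertices are sorted by degree.  It remains to
   maximise the weight over partitions of e into distinct parts at most n
   (n = v - 1).  Complementing the set of parts in {1, ..., n} corresponds to
   complementing the graph; it changes the weight by a quantity depending only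
   on n and e, and exchanges (2.1), (2.2), (2.3) with (1.1), (1.2), (1.3).
   By induction on n, up to complementation an optimal partition of bound n + 1
   is (n + 1) :: q with q optimal of bound n.  If q is of star type, so is
   (n + 1) :: q.  If q is a quasi-complete graph, then (n + 1) :: q adds a
   dominating vertex and pendant vertices to it, and moving a block of cells
   gives a strictly larger weight except in the listed cases. *)
Require Import Defs.
From mathcomp Require Import all_boot fingroup perm zify.

Set Implicit Arguments.
Unset Strict Implicit.
Unset Printing Implicit Defensive.

(** * Partitions into distinct parts at most [n] *)

Definition dis (n : nat) (p : seq nat) : bool := path gtn n.+1 p && (0 \notin p).

(** Used up to permutation: the multiset determines the number of edges (its size), the weight (its
    sum) and the diagonal sequence (its multiplicities). *)
Definition diag (p : seq nat) : seq nat := [seq st.1 + st.2 | st <- cells p].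

Definition weight (p : seq nat) : nat := sumn (diag p).

Definition compl (n : nat) (p : seq nat) : seq nat :=
  [seq a <- down n 1 | a \notin p].

Lemma is_DisE n e p : is_Dis n.+1 e p = dis n p && (sumn p == e).
Proof. by rewrite /is_Dis /dis andbA. Qed.

Lemma gtn_trans : transitive gtn.
Proof. by move=> y x z /= h1 h2; apply: ltn_trans h1. Qed.

Lemma disE n p : dis n p = sorted gtn p && all (fun a => 0 < a <= n) p.
Proof.
rewrite /dis path_sortedE; last exact: gtn_trans.
rewrite [all _ _ && _]andbC -andbA; congr andb.
elim: p => //= a p IH; rewrite inE negb_or -IH; case: a => [|a]; rewrite ?andbF //=.
by rewrite ltnS andbA.
Qed.

Lemma dis_ext n p q : dis n p -> dis n q -> p =i q -> p = q.
Proof.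
rewrite !disE => /andP[sp _] /andP[sq _].
by apply: (irr_sorted_eq gtn_trans) => // x; rewrite /= ltnn.
Qed.

Lemma dis_mem n p a : dis n p -> a \in p -> 0 < a <= n.
Proof. by rewrite disE => /andP[_ /allP h] /h. Qed.

Lemma dis_cons n a p : dis n (a :: p) = (0 < a <= n) && dis a.-1 p.
Proof.
rewrite /dis /= inE negb_or; case: a => [|a] /=; first by rewrite andbF.
by rewrite ltnS -andbA.
Qed.

Lemma dis_filter n p (P : pred nat) : dis n p -> dis n (filter P p).
Proof.
rewrite !disE => /andP[sp ap]; rewrite sorted_filter ?sp //=; last exact: gtn_trans.
by apply/allP => a; rewrite mem_filter => /andP[_ /(allP ap)].
Qed.

Lemma mem_down hi lo a : (a \in down hi lo) = (lo <= a <= hi).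
Proof. rewrite /down mem_rev mem_iota; lia. Qed.

Lemma downS hi lo : lo <= hi.+1 -> down hi.+1 lo = hi.+1 :: down hi lo.
Proof.
move=> h; rewrite /down subSn // -addn1 iotaD rev_cat /=.
by congr (_ :: _); lia.
Qed.

Lemma down_nil hi lo : hi < lo -> down hi lo = [::].
Proof. by move=> h; rewrite /down (_ : _ - _ = 0) //; lia. Qed.

Lemma dis_down n hi lo : hi <= n -> 0 < lo -> dis n (down hi lo).
Proof.
move=> hn hlo; rewrite disE /down rev_sorted iota_ltn_sorted /=.
by apply/allP => a; rewrite mem_rev mem_iota; lia.
Qed.

Lemma dis_pi21 n k j : k <= n -> dis n (pi21 k j).
Proof. by move=> h; rewrite /pi21 dis_filter // dis_down. Qed.

Lemma pi21S k j : pi21 k.+1 j = if k.+1 == j then pi21 k j else k.+1 :: pi21 k j.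
Proof. by rewrite /pi21 downS //=; case: eqP. Qed.

Lemma pi21_id k j : ~~ (0 < j <= k) -> pi21 k j = down k 1.
Proof.
move=> h; rewrite /pi21; apply/all_filterP/allP => a; rewrite mem_down; lia.
Qed.

Lemma pi21_diag k : pi21 k k = down k.-1 1.
Proof. by case: k => [|k] //; rewrite pi21S eqxx pi21_id //=; lia. Qed.

(** * Recursion on the first row for diagonals and weights *)

Lemma diag_cons x p : diag (x :: p) = iota 1 x ++ [seq d.+2 | d <- diag p].
Proof.
rewrite /diag /cells /= map_cat -map_comp; congr cat.
  by rewrite -[RHS]map_id; apply/eq_map.
(* A new first row moves every old cell by (1, 1), hence its diagonal by 2. *)
rewrite -(addn0 1) iotaDl !map_allpairs allpairs_mapl.
elim: (iota 0 (size p)) => //= s l ->; congr cat.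
rewrite !add1n -[s.+2]addn1 addnC iotaDl -!map_comp; apply/eq_map => t /=; lia.
Qed.

Lemma size_diag p : size (diag p) = sumn p.
Proof.
by elim: p => //= x p IH; rewrite diag_cons size_cat size_iota size_map IH.
Qed.

Lemma weight_cons x p :
  2 * weight (x :: p) = x * x.+1 + 4 * sumn p + 2 * weight p.
Proof.
rewrite /weight diag_cons sumn_cat -(size_diag p).
have -> : sumn [seq d.+2 | d <- diag p] = sumn (diag p) + 2 * size (diag p).
  by elim: (diag p) => //= a l ->; lia.
have h : 2 * sumn (iota 1 x) = x * x.+1.
  by elim: x => // x IH; rewrite -[X in iota _ X]addn1 iotaD sumn_cat mulnDr IH /=; lia.
by move: h; lia.
Qed.

Lemma sum_pi21 k j : 0 < j <= k -> 2 * sumn (pi21 k j) + 2 * j = k * k.+1.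
Proof.
have hd m : 2 * sumn (down m 1) = m * m.+1.
  by elim: m => // m IH; rewrite downS //=; lia.
elim: k => [|k IH] h; first lia.
rewrite pi21S; case: eqP => [<-|ne].
  by rewrite pi21_id; [move: (hd k) | ]; lia.
have : 0 < j <= k by lia.
by move/IH => /=; lia.
Qed.

Lemma sum_down k : 2 * sumn (down k 1) = k * k.+1.
Proof. by elim: k => // k IH; rewrite downS //=; lia. Qed.

Lemma weight_down k : 2 * weight (down k 1) = k * k * k.+1.
Proof.
elim: k => // k IH; rewrite downS // weight_cons; move: (sum_down k); nia.
Qed.

Lemma weight_pi21 k j : 0 < j <= k ->
  2 * weight (pi21 k j) + 4 * (k * j) = k * k * k.+1 + j * j + j.
Proof.
elim: k => [|k IH] h; first lia.
rewrite pi21S; case: eqP => [<-|ne].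
  by rewrite pi21_id; [move: (weight_down k) | ]; nia.
have h' : 0 < j <= k by lia.
rewrite weight_cons; move: (IH h') (sum_pi21 h'); nia.
Qed.

(** * Complementing the set of parts *)

Lemma complS n p :
  compl n.+1 p = if n.+1 \in p then compl n p else n.+1 :: compl n p.
Proof. by rewrite /compl downS //=; case: (_ \in _). Qed.

Lemma dis_compl n p : dis n (compl n p).
Proof. by rewrite /compl dis_filter // dis_down. Qed.

Lemma mem_compl n p a : (a \in compl n p) = (a \notin p) && (0 < a <= n).
Proof. by rewrite mem_filter mem_down. Qed.

Lemma complK n p : dis n p -> compl n (compl n p) = p.
Proof.
move=> dp; apply: (@dis_ext n) => //; first exact: dis_compl.
move=> a; rewrite !mem_compl negb_and negbK andb_orl andNb orbF.
by case: (boolP (a \in p)) => //= /(dis_mem dp).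
Qed.

(** The part [n.+1] belongs to exactly one of a partition and its complement; inductions on [n]
    split on which one has it. *)
Lemma disS n p : dis n.+1 p ->
  (dis n p /\ compl n.+1 p = n.+1 :: compl n p) \/
  (exists q, [/\ p = n.+1 :: q, dis n q & compl n.+1 p = compl n q]).
Proof.
case: p => [|a p] /=; first by left; rewrite complS.
rewrite dis_cons => /andP[ha dp]; case: (eqVneq a n.+1) dp => [-> /= dp|ne dp].
  right; exists p; split=> //; rewrite complS inE eqxx /=.
  apply: eq_in_filter => b; rewrite mem_down inE; lia.
left; have d: dis n (a :: p) by rewrite dis_cons dp andbT; lia.
split=> //; rewrite complS; case: ifP => // /(dis_mem d); lia.
Qed.

Lemma sum_compl n p : dis n p -> 2 * (sumn (compl n p) + sumn p) = n * n.+1.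
Proof.
elim: n p => [|n IH] p.
  by case: p => // a p; rewrite dis_cons; lia.
by case/disS => [[d ->]|[q [-> d ->]]] /=; move: (IH _ d); lia.
Qed.

(** In terms of degrees this is the sum of (n - d)^2 over the n + 1 vertices, with 2 [weight p] the
    sum of squared degrees and 2 [sumn p] the sum of degrees. *)
Lemma weight_compl n p : dis n p ->
  2 * weight (compl n p) + 4 * (n * sumn p) = 2 * weight p + n * n * n.+1.
Proof.
elim: n p => [|n IH] p.
  by case: p => // a p; rewrite dis_cons; lia.
case/disS => [[d ->]|[q [-> d ->]]]; rewrite weight_cons /=;
  move: (IH _ d) (sum_compl d); nia.
Qed.

(** * Partitions of maximal weight *)

Definition optp n p :=
  dis n p /\ forall q, dis n q -> sumn q = sumn p -> weight q <= weight p.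

Lemma optp_compl n p : optp n p -> optp n (compl n p).
Proof.
move=> [dp hp]; split=> [|q dq eq]; first exact: dis_compl.
have := hp _ (dis_compl n q).
have sq : sumn (compl n q) = sumn p.
  by move: (sum_compl dp) (sum_compl dq); rewrite eq; lia.
move=> /(_ sq); move: (weight_compl dp) (weight_compl dq) eq (sum_compl dp).
nia.
Qed.

(** Prepending [n.+1] changes the weight by an amount that depends only on [n] and the sum. *)
Lemma optp_behead n p : optp n.+1 (n.+1 :: p) -> optp n p.
Proof.
move=> [+ hp]; rewrite dis_cons /= => /andP[_ dp]; split=> // q dq eq.
have := hp (n.+1 :: q); rewrite dis_cons /= ltnSn dq eq => /(_ isT erefl).
rewrite -(leq_pmul2l (m := 2)) // !weight_cons eq; lia.
Qed.

Lemma optp_eq n p q : optp n p -> dis n q -> sumn q = sumn p ->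
  weight q = weight p -> optp n q.
Proof. by move=> [dp hp] dq es ew; split=> // s ds; rewrite es ew; apply: hp. Qed.

Lemma optp_le n p q : optp n p -> dis n q -> sumn q = sumn p ->
  2 * weight q <= 2 * weight p.
Proof. by move=> [_ hp] dq es; rewrite leq_pmul2l // hp. Qed.

(** * A dominating vertex over a quasi-complete graph *)

Lemma dis_pi21_head n a k j : k < a <= n -> dis n (a :: pi21 k j).
Proof. by move=> h; rewrite dis_cons dis_pi21 ?andbT; lia. Qed.

(* The competitor turns min(j, n - k) of the pendant edges into edges at the
   vertex of the quasi-complete part that misses j neighbours. *)
Lemma dominating_pendants n k j : 0 < j <= k -> k < n ->
  optp n.+1 (n.+1 :: pi21 k j) -> k + k <= n \/ j = k.
Proof.
move=> hj hk ho; case: (leqP k (n - k)) => hm; first by left; lia.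
right; apply/eqP; case: eqP => // jk.
have := sum_pi21 hj; have := weight_pi21 hj => w1 s1.
case: (leqP j (n - k)) => hjm.
  (* Here [pi21 k 0] stands for the full [down k 1]: all [j] missing edges get filled in. *)
  have dq : dis n.+1 (n.+1 - j :: pi21 k 0) by rewrite dis_pi21_head //; lia.
  have s2 := sum_down k; have w2 := weight_down k.
  have := optp_le ho dq; rewrite !weight_cons /= pi21_id // => h.
  have {}h := h ltac:(lia).
  have [m nE] : exists m, n = m + k by exists (n - k); lia.
  have [r kE] : exists r, k = m + r.+1 by exists (k - m.+1); lia.
  have [t mE] : exists t, m = j + t by exists (m - j); lia.
  subst n k m.
  have e : (j + t + (j + t + r.+1)).+1 - j = (t + (j + t + r.+1)).+1 by lia.
  (* This is the gain in weight, j(2k - n). *)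
  have g : 0 < j * r.+1 by rewrite muln_gt0; lia.
  rewrite e in h; lia.
have dq : dis n.+1 (k.+1 :: pi21 k (j - (n - k))).
  by rewrite dis_pi21_head //; lia.
have hj' : 0 < j - (n - k) <= k by lia.
have s2 := sum_pi21 hj'; have w2 := weight_pi21 hj'.
have := optp_le ho dq; rewrite !weight_cons /= => h.
have {}h := h ltac:(lia).
have [m nE] : exists m, n = m + k by exists (n - k); lia.
have [i jE] : exists i, j = m + i by exists (j - m); lia.
have [r kE] : exists r, k = j + r.+1 by exists (k - j.+1); lia.
subst n j; move: s2 w2 h hj'.
have -> : m + k - k = m by lia.
have -> : m + i - m = i by lia.
move=> s2 w2 h hj'.
(* The gain in weight is (n - k)(k - j); it would vanish for j = k. *)
have g : 0 < m * r.+1 by rewrite muln_gt0; lia.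
lia.
Qed.

(* p has the size and weight of a clique on k + 2 vertices plus a vertex joined
   to r of them.  The competitor makes that vertex pendant, deletes w edges at
   another clique vertex, and attaches all the freed edges to the first
   vertex. *)
Lemma dominating_star n k r p : 0 < k -> 0 < r <= k.+2 -> (k + k).+4 <= n ->
  2 * sumn p = k.+2 * k.+1 + 2 * r ->
  2 * weight p + r * (k.+1 * k.+1) =
    r * r + r * (k.+2 * k.+2) + k.+2 * (k.+1 * k.+1) ->
  ~ optp n.+1 (n.+1 :: p).
Proof.
move=> hk hr hn s1 w1 /optp_behead ho.
(* The competitor gains w(r + w - k) in weight; [w] must make this positive while its first part
   stays within [n]. *)
have [w [hw a_n gain]] : exists w, [/\ 0 < w <= k, k.+1 + r + w <= n & k < r + w].
  by case: (leqP k r) => h; [exists 1 | exists (k.+1 - r)]; split; lia.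
have dq : dis n (k.+1 + r + w :: pi21 k w) by rewrite dis_pi21_head //; lia.
have s2 := sum_pi21 hw; have w2 := weight_pi21 hw.
have := optp_le ho dq; rewrite !weight_cons /= => h.
have {}h := h ltac:(lia).
have [c kE] : exists c, k = w + c by exists (k - w); lia.
have [z rE] : exists z, r = c + z.+1 by exists (r + w - k.+1); lia.
have g : 0 < w * z.+1 by rewrite muln_gt0; lia.
subst k r; lia.
Qed.

(** For n < 2k moving pendant edges forces j = k. For 2k <= n the bound leaves room for a larger
    star, which wins unless the quasi-complete part is very small. *)
Lemma dominating_pi21 n k j : 0 < j <= k -> k < n ->
  optp n.+1 (n.+1 :: pi21 k j) ->
  (j = k /\ n < k + k) \/ k <= 2 \/ (k = 3 /\ j = 3).
Proof.
move=> hj hk ho; case: (leqP k 2) => h2; first by right; left.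
case: (leqP (k + k) n) => hn; last first.
  by case: (dominating_pendants hj hk ho) => h; left; lia.
have s1 := sum_pi21 hj; have w1 := weight_pi21 hj.
case: (eqVneq j k) => [jk|jk].
  case: (eqVneq k 3) => k3; first by right; right; lia.
  have [i kE] : exists i, k = i.+4 by exists (k - 4); lia.
  (* For j = k the graph is a clique on k vertices, seen as one on k - 1 vertices plus a vertex
     joined to all of them. *)
  case: (@dominating_star n i.+1 i.+3 (pi21 k j)) => //; try lia; subst k j; lia.
have [i kE] : exists i, k = i.+2 by exists (k - 2); lia.
have [r kr] : exists r, k = j + r by exists (k - j); lia.
(* Otherwise it is a clique on k vertices plus a vertex joined to k - j of them. *)
by case: (@dominating_star n i r (pi21 k j)) => //; try lia; subst k; nia.
Qed.

(** * Listed partitions with the same diagonals *)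

Lemma down_cat hi mid lo : lo <= mid.+1 -> mid <= hi ->
  down hi lo = down hi mid.+1 ++ down mid lo.
Proof.
move=> h1 h2; rewrite /down -rev_cat.
have -> : hi.+1 - lo = (mid.+1 - lo) + (hi.+1 - mid.+1) by lia.
by rewrite iotaD; congr (rev (_ ++ iota _ _)); lia.
Qed.

Lemma down_lo n : down n n = [:: n].
Proof. by rewrite /down subSnn. Qed.

Lemma pi21_cat k j : 0 < j <= k -> pi21 k j = down k j.+1 ++ down j.-1 1.
Proof.
move=> h; rewrite /pi21 (@down_cat k j 1); [| lia..].
rewrite (@down_cat j j.-1 1) ?prednK; [| lia..].
rewrite down_lo !filter_cat /= eqxx; congr cat; apply/all_filterP/allP => a;
  rewrite mem_down; lia.
Qed.

Lemma map_addSS_iota m n : [seq d.+2 | d <- iota m n] = iota m.+2 n.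
Proof. by rewrite -(addn2 m) addnC iotaDl. Qed.

Lemma diag_catl p q q' : perm_eq (diag q) (diag q') ->
  perm_eq (diag (p ++ q)) (diag (p ++ q')).
Proof.
by move=> h; elim: p => //= x p IH; rewrite !diag_cons perm_cat2l perm_map.
Qed.

(* Every row of the first block of parts grows by a cell in the column c + lo. *)
Lemma diag_grow_rows c lo q : 0 < lo ->
  perm_eq (diag (down (c + lo) lo.+1 ++ q))
          (diag (down (c + lo).-1 lo ++ q) ++ iota (c + lo) c).
Proof.
move=> lo0; elim: c => [|c IH].
  by rewrite !down_nil ?cats0 //; lia.
rewrite addSn downS; last lia; rewrite /=.
have -> : down (c + lo) lo = c + lo :: down (c + lo).-1 lo.
  by rewrite -[in LHS](@prednK (c + lo)) ?downS ?prednK //; lia.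
move/(perm_map (fun d => d.+2)): IH; rewrite map_cat map_addSS_iota => /seq.permP IH.
rewrite /= !diag_cons; apply/seq.permP => P; rewrite !count_cat IH count_cat /=.
have := congr1 (count P) (iotaD 1 (c + lo) 1).
by rewrite count_cat addn1 /= add1n; lia.
Qed.

Lemma diag_grow_last p a b :
  perm_eq (diag (rcons p (a + b)))
          (diag (rcons p a) ++ iota (2 * size p + a).+1 b).
Proof.
elim: p => [|x p IH] /=; first by rewrite !diag_cons !cats0 iotaD.
rewrite !diag_cons -catA perm_cat2l.
move/(perm_map (fun d => d.+2)): IH; rewrite map_cat map_addSS_iota.
by rewrite mulnS.
Qed.

(** Both sides add k - j cells, on the diagonals k, ..., 2k - j - 1, to the triangle [down k.-1 1]:
    at the end of its first row, or as one column. *)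
Lemma diag_pi22 k j : 0 < j -> j.+2 <= k ->
  perm_eq (diag (pi22 k j)) (diag (pi21 k j)).
Proof.
move=> j0 jk; rewrite pi21_cat; last lia.
have := @diag_grow_rows (k - j) j (down j.-1 1) j0.
rewrite subnK; last lia; move=> h; rewrite perm_sym.
apply: perm_trans h _; have e := @down_cat k.-1 j.-1 1.
rewrite prednK // in e; rewrite -e; [| lia..].
have -> : k.-1 = (k - 2).+1 by lia.
rewrite downS // /pi22 !diag_cons.
have -> : 2 * k - j - 1 = (k - 2).+1 + (k - j) by lia.
rewrite iotaD (_ : 1 + (k - 2).+1 = k); last lia.
by apply/seq.permP => P; rewrite !count_cat; lia.
Qed.

(** The two partitions differ only in their tails [[:: 3]] and [[:: 2; 1]], a star and a triangle,
    both with diagonals 1, 2, 3. *)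
Lemma diag_pi23 k : 2 < k -> perm_eq (diag (pi23 k)) (diag (pi21 k 3)).
Proof.
move=> k3; rewrite pi21_cat /pi23 ?(@down_cat k 3 3) //.
exact: diag_catl.
Qed.

Lemma diag_pi13 v k : k != v -> perm_eq (diag (pi13 v k)) (diag (pi11 v k 3)).
Proof.
by move=> /negbTE kv; rewrite /pi11 kv /pi13 -cats1; apply: diag_catl.
Qed.

Lemma pi12_cat v k j : pi12_exists v k j ->
  pi12 v k j = down (v - 1) (2 * k - j) ++ down (2 * k - j - 2) (k - 1).
Proof.
move=> h; rewrite /pi12_exists in h.
rewrite /pi12 (@down_cat (v - 1) (2 * k - j - 1)); [| lia..].
rewrite (@down_cat (2 * k - j - 1) (2 * k - j - 2) (k - 1)); [| lia..].
rewrite (_ : (2 * k - j - 2).+1 = 2 * k - j - 1); last lia.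
rewrite down_lo !filter_cat /= eqxx.
rewrite (_ : (2 * k - j - 1).+1 = 2 * k - j); last lia.
by congr cat; apply/all_filterP/allP => a; rewrite mem_down; lia.
Qed.

(** Past the common large parts, a column of k - j - 1 cells moves to the end of the last row, which
    grows from j to k - 1; the diagonals covered are the same. *)
Lemma diag_pi12 v k j : 0 < j -> pi12_exists v k j ->
  perm_eq (diag (pi12 v k j)) (diag (pi11 v k j)).
Proof.
move=> j0 h; rewrite pi12_cat // /pi11; rewrite /pi12_exists in h.
rewrite ifF; last lia; rewrite (@down_cat (v - 1) (2 * k - j - 1) (k + 1)); [| lia..].
rewrite rcons_cat (_ : (2 * k - j - 1).+1 = 2 * k - j); last lia.
apply: diag_catl; set c := k - j - 1.
have := @diag_grow_rows c k [:: j] ltac:(lia).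
have -> : c + k = 2 * k - j - 1 by lia.
rewrite !cats1 perm_sym addn1; apply: perm_trans.
rewrite (@down_cat _ (k - 1) (k - 1)); [| lia..].
rewrite down_lo cats1.
rewrite (_ : (k - 1).+1 = k); last lia.
rewrite (_ : (2 * k - j - 1).-1 = 2 * k - j - 2); last lia.
have := diag_grow_last (down (2 * k - j - 2) k) j c.
rewrite (_ : j + c = k - 1); last lia.
congr (perm_eq _ (_ ++ iota _ _)); rewrite /down size_rev size_iota; lia.
Qed.

Lemma perm_sum p q : perm_eq (diag p) (diag q) -> sumn p = sumn q.
Proof. by move/perm_size; rewrite !size_diag. Qed.

Lemma perm_weight p q : perm_eq (diag p) (diag q) -> weight p = weight q.
Proof. exact: perm_sumn. Qed.

Lemma perm_diagonal_sequence p q : perm_eq (diag p) (diag q) ->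
  diagonal_sequence p = diagonal_sequence q.
Proof.
move=> h; rewrite /diagonal_sequence -!(big_map (fun st => st.1 + st.2) xpredT id).
rewrite -!/(diag _) (perm_big _ h); apply/eq_map => i; rewrite /delta.
by move/seq.permP: h => /(_ (pred1 i)); rewrite /diag !count_map.
Qed.

(** * Optimal partitions are quasi-complete up to complement *)

Definition quasi_complete n p := exists k j, 0 < j <= k /\
  (p = pi21 k j \/ (pi22_exists n.+1 k j /\ p = pi22 k j) \/
   (pi23_exists n.+1 j /\ p = pi23 k)).

(** For j = k the part [k] is itself missing, so [k] may exceed [n] by one: this is the complete
    graph on n + 1 vertices. *)
Lemma dis_pi21_bound n k j : 0 < j <= k -> dis n (pi21 k j) ->
  k <= n \/ k = n.+1 /\ j = n.+1.
Proof.
move=> hj d; case: (eqVneq j k) => [jk|jk].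
  case: (ltnP 1 k) => k1; last lia.
  have /(dis_mem d) : k.-1 \in pi21 k j by rewrite mem_filter mem_down; lia.
  lia.
have /(dis_mem d) : k \in pi21 k j by rewrite mem_filter mem_down; lia.
by left; lia.
Qed.

Lemma compl_seq1 n a : compl n [:: a] = pi21 n a.
Proof. by apply: eq_filter => b; rewrite inE. Qed.

Lemma compl_nil n : compl n [::] = down n 1.
Proof. by apply/all_filterP/allP. Qed.

Lemma dis_pi23 n k : k <= n -> dis n (pi23 k).
Proof. by move=> h; apply: dis_down. Qed.

Lemma compl_21 n : 1 < n -> compl n [:: 2; 1] = pi23 n.
Proof.
move=> n1; apply: (@dis_ext n); [exact: dis_compl | exact: dis_pi23 |].
move=> a; rewrite mem_compl mem_down !inE; lia.
Qed.

Lemma quasi_complete_widen n p : quasi_complete n p -> quasi_complete n.+1 p.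
Proof.
case=> k [j [hj H]]; exists k, j; split=> //.
case: H => [->|[[h ->]|[h ->]]]; [by left| right; left| right; right];
  split=> //; move: h; rewrite /pi22_exists /pi23_exists; lia.
Qed.

Lemma optp_cons_perm n p q : dis n q -> perm_eq (diag p) (diag q) ->
  optp n.+1 (n.+1 :: p) -> optp n.+1 (n.+1 :: q).
Proof.
move=> dq h ho; apply: (optp_eq ho).
- by rewrite dis_cons dq ltnSn.
- by rewrite /= (perm_sum h).
- by apply/esym/perm_weight; rewrite !diag_cons perm_cat2l perm_map.
Qed.

(** [compl n p] is also the complement of [n.+1 :: p] for the bound [n.+1]. Since (2.2) and (2.3)
    share their diagonals with (2.1), [dominating_pi21] decides all three cases. *)
Lemma dominating_quasi_complete n p : quasi_complete n p ->
  optp n.+1 (n.+1 :: p) ->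
  quasi_complete n.+1 (n.+1 :: p) \/ quasi_complete n.+1 (compl n p).
Proof.
case=> k [j [hj H]] ho; have dp : dis n p.
  by case: ho => + _; rewrite dis_cons => /andP[].
case: H => [e|[[hx e]|[hx e]]]; subst p.
- case: (dis_pi21_bound hj dp) => [|[-> ->]]; last first.
    left; exists n.+2, n.+2; split; first lia.
    by left; rewrite !pi21_diag /= downS.
  rewrite leq_eqVlt => /orP[/eqP kn|kn].
    left; exists n.+1, j; split; first lia.
    by left; rewrite pi21S ifF ?kn //; lia.
  case: (dominating_pi21 hj kn ho) => [[jk n2k]|[k2|[k3 j3]]].
  (* A clique with a dominating vertex is of type (2.2); the new [j] solves 2(k + 1) - j - 1 = n +
     1. *)
  + left; exists k.+1, (2 * k - n); split; first lia.
    right; left; split; first by rewrite /pi22_exists; lia.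
    by rewrite jk pi21_diag /pi22; congr (_ :: down _ _); lia.
  + right; case: (leqP k 1) => k1.
      have [-> ->] : k = 1 /\ j = 1 by lia.
      rewrite /pi21 /= compl_nil; exists n.+1, n.+1; split; first lia.
      by left; rewrite pi21_diag.
    have -> : k = 2 by lia.
    case: (eqVneq j 1) => [->|j1].
      rewrite [pi21 2 1]/= compl_seq1; exists n, 2; split; [lia | by left].
    have -> : j = 2 by lia.
    rewrite [pi21 2 2]/= compl_seq1; exists n, 1; split; [lia | by left].
  + right; rewrite k3 j3 [pi21 3 3]/= compl_21; last lia.
    exists n, 3; split; first lia.
    by right; right; split => //; rewrite /pi23_exists; lia.
- rewrite /pi22_exists in hx.
  have d21 : dis n (pi21 k j) by apply: dis_pi21; lia.
  have kn : k < n by lia.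
  have := @optp_cons_perm _ _ _ d21 (@diag_pi22 k j ltac:(lia) ltac:(lia)) ho.
  (* Type (2.2) needs j + 2 <= k, which contradicts every surviving case. *)
  by case/(dominating_pi21 hj kn) => [[]|[|[]]]; lia.
- have [j3 n3] := andP hx; have {}j3 := eqP j3; subst j.
  have kn : k <= n.
    have /(dis_mem dp) : k \in pi23 k by rewrite mem_down; lia.
    by lia.
  case: (eqVneq k n) => [->|ne].
    left; exists n.+1, 3; split; first lia.
    right; right; split; first by rewrite /pi23_exists; lia.
    by rewrite /pi23 downS //; lia.
  have kn' : k < n by lia.
  have := @optp_cons_perm _ _ _ (dis_pi21 3 kn) (@diag_pi23 k ltac:(lia)) ho.
  move=> /(dominating_pi21 hj kn') h.
  have -> : k = 3 by case: h => [[]|[|[]]]; lia.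
  right; rewrite /pi23 down_lo compl_seq1; exists n, 3; split; [lia | by left].
Qed.

(** One of [p] and [compl n p] starts with the largest possible part, and both are optimal. Removing
    that part gives an optimal partition for the induction hypothesis. *)
Lemma optp_quasi n p : optp n p ->
  quasi_complete n p \/ quasi_complete n (compl n p).
Proof.
elim: n p => [|n IH] p ho.
  left; exists 1, 1; split=> //; left; case: ho => + _; case: p => // a p.
  by rewrite dis_cons; lia.
have step q : dis n q -> optp n.+1 (n.+1 :: q) ->
    quasi_complete n.+1 (n.+1 :: q) \/ quasi_complete n.+1 (compl n q).
  move=> dq hq; case: (IH _ (optp_behead hq)) => h.
    exact: dominating_quasi_complete.
  by right; apply: quasi_complete_widen.
case: (disS (proj1 ho)) => [[dp ep]|[q [ep dq eq]]].
  have := optp_compl ho; rewrite ep => h.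
  by case: (step _ (dis_compl n p) h); rewrite ?complK //; [right | left].
by rewrite eq ep; apply: step => //; rewrite -ep.
Qed.

(** * Star types as complements of quasi-complete types *)

Lemma dis_down_cat n k q : k <= n -> dis k q -> dis n (down n k.+1 ++ q).
Proof.
move=> /subnKC <-; elim: (n - k) => [|m IH] dq; first by rewrite addn0 down_nil.
rewrite addnS downS ?cat_cons ?dis_cons ?IH ?ltnSn //; lia.
Qed.

Lemma compl_pi21 n k j : 0 < j <= k -> k <= n \/ k = n.+1 /\ j = n.+1 ->
  compl n (pi21 k j) = pi11 n.+1 k j.
Proof.
move=> hj [hk|[-> ->]]; last first.
  (* The complete graph has the empty complement, the special case of [pi11]. *)
  rewrite pi21_diag /pi11 eqxx /=; apply: (@dis_ext n) => //.
    exact: dis_compl.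
  by move=> a; rewrite mem_compl mem_down in_nil; lia.
rewrite /pi11 ifF; last lia.
rewrite -cats1 subn1 addn1; apply: (@dis_ext n); first exact: dis_compl.
  by apply: dis_down_cat => //; rewrite dis_cons hj.
by move=> a; rewrite mem_compl mem_cat mem_filter !mem_down inE; lia.
Qed.

Lemma compl_pi22 n k j : 0 < j -> pi22_exists n.+1 k j ->
  compl n (pi22 k j) = pi12 n.+1 k j.
Proof.
rewrite /pi22_exists => j0 h; apply: (@dis_ext n); first exact: dis_compl.
  by rewrite dis_filter // dis_down //; lia.
by move=> a; rewrite mem_compl mem_filter inE !mem_down; lia.
Qed.

Lemma compl_pi23 n k : 2 < k <= n -> compl n (pi23 k) = pi13 n.+1 k.
Proof.
move=> h; apply: (@dis_ext n); first exact: dis_compl.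
  rewrite /pi13 subn1 addn1; apply: dis_down_cat; first lia.
  by rewrite dis_cons; apply/andP; split=> //; lia.
by move=> a; rewrite mem_compl mem_cat !mem_down !inE; lia.
Qed.

(** * Existence and uniqueness of the parameters *)

Lemma qc_exists e : exists k j, qc_params e k j.
Proof.
elim: e => [|e [k [j [hj he]]]]; first by exists 1, 1.
case: (ltnP 1 j) => j1; first by exists k, j.-1; split; lia.
by exists k.+1, k.+1; split; rewrite 1?binS ?bin1; lia.
Qed.

Lemma qc_unique e k j k' j' : qc_params e k j -> qc_params e k' j' ->
  k = k' /\ j = j'.
Proof.
move=> [hj h] [hj' h'].
(* If a < b, then e >= 'C(b, 2) >= 'C(a + 1, 2) = e + d > e. *)
have lt a b c d : 0 < c <= b -> 0 < d <= a -> e + c = 'C(b.+1, 2) ->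
    e + d = 'C(a.+1, 2) -> ~~ (a < b).
  move=> h1 h2 e1 e2; apply/negP => ab.
  have := leq_bin2l 2 ab; move: e1; rewrite binS bin1; lia.
have := lt _ _ _ _ hj hj' h h'; have := lt _ _ _ _ hj' hj h' h => h1 h2.
have e0 : k = k' by lia.
by subst k'; lia.
Qed.

Lemma qs_qc v e k j : e <= 'C(v, 2) ->
  qs_params v e k j <-> qc_params ('C(v, 2) - e) k j.
Proof. by move=> he; split=> -[h1 h2]; split=> //; lia. Qed.

(** * Squared degrees of a threshold graph *)

Lemma mem_cells p s t : ((s, t) \in cells p) = (s < t <= s + nth 0 p s).
Proof.
apply/allpairsPdep/idP => [[s' [t' []]]|h].
  by rewrite !mem_iota => hs ht [-> ->]; lia.
exists s, t; split=> //; rewrite mem_iota; last lia.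
by case: (ltnP s (size p)) h => // /(nth_default 0) ->; lia.
Qed.

Lemma dis_nth_le n p s : dis n p -> 0 < nth 0 p s -> s + nth 0 p s <= n.
Proof.
elim: p n s => [|a p IH] n [|s]; rewrite ?nth_nil // dis_cons /=; first lia.
by move=> /andP[h1 /IH h2] /h2; lia.
Qed.

(** Parts drop by at least one per row, so the right ends of the rows never move outwards; this
    makes the adjacency relation shifted. *)
Lemma dis_nth_mono n p s s' : dis n p -> s' <= s -> 0 < nth 0 p s ->
  s + nth 0 p s <= s' + nth 0 p s'.
Proof.
elim: p n s s' => [|a p IH] n [|s] [|s']; rewrite ?nth_nil // dis_cons => /andP[h d] //=.
  by move=> _ /(dis_nth_le d); lia.
by rewrite ltnS => ss /(IH _ _ _ d ss); lia.
Qed.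

Lemma dis_size n p : dis n p -> size p <= n.
Proof.
elim: p n => //= a p IH n; rewrite dis_cons => /andP[h /IH]; lia.
Qed.

Lemma sum_cells n p (F : nat -> nat -> nat) : dis n p ->
  \sum_(i < n.+1) \sum_(j < n.+1) (i < j <= i + nth 0 p i) * F i j =
  \sum_(st <- cells p) F st.1 st.2.
Proof.
move=> dp; rewrite big_allpairs_dep /=.
pose G i := \sum_(t <- iota i.+1 (nth 0 p i)) F i t.
have row (i : 'I_n.+1) :
    \sum_(j < n.+1) (i < j <= i + nth 0 p i) * F i j = G i.
  have -> : G i = \sum_(i.+1 <= t < (i + nth 0 p i).+1) F i t.
    by rewrite /G /index_iota; congr (\sum_(t <- iota _ _) _); lia.
  have le : (i + nth 0 p i).+1 <= n.+1.
    case: (posnP (nth 0 p i)) => [->|/(dis_nth_le dp)]; last lia.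
    by rewrite addn0.
  rewrite (big_nat_widen _ _ _ _ _ le) (big_nat_widenl _ 0) // big_mkord.
  rewrite [RHS]big_mkcond; apply: eq_bigr => j _ /=.
  by rewrite ltnS andbC; case: (_ && _); rewrite ?mul1n ?mul0n.
rewrite (eq_bigr (fun i : 'I_n.+1 => G i)) // -(big_mkord xpredT G).
rewrite (@big_cat_nat _ _ _ (size p)) //=; last first.
  exact: leqW (dis_size dp).
rewrite [X in _ + X]big_nat_cond [X in _ + X]big1 => [|i].
  by rewrite addn0 /index_iota subn0.
by rewrite /G andbT => /andP[/(nth_default 0) ->]; rewrite big_nil.
Qed.

(** The d neighbours of [i] are the d smallest vertices other than [i]. Their sum is therefore d(d -
    1)/2, plus one for each neighbour beyond [i]. *)
Lemma square_initial m (a : nat -> bool) i :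
  ~~ a i -> (forall x y, a y -> x < y -> x != i -> a x) ->
  (\sum_(j < m) a j) ^ 2 + 2 * \sum_(j < m) a j * (i < j) =
  \sum_(j < m) a j + 2 * \sum_(j < m) a j * j.
Proof.
move=> ai ad; elim: m => [|m IH]; first by rewrite !big_ord0.
rewrite !big_ord_recr /=; case: (boolP (a m)) => am; last first.
  by rewrite !mul0n !addn0.
have e : \sum_(j < m) a j + (i < m) = m.
  have -> : \sum_(j < m) a j = \sum_(j < m) (j != i :> nat).
    apply: eq_bigr => j _; case: (eqVneq (j : nat) i) => [->|ji].
      by rewrite (negbTE ai).
    by rewrite (ad _ _ am).
  elim: (m) => [|k IHk]; first by rewrite big_ord0.
  rewrite big_ord_recr /=; move: IHk; set s := \sum_(_ < k) _.
  by case: ltngtP; lia.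
move: IH e; move: (\sum_(j < m) a j) (\sum_(j < m) _ * (i < j)).
move: (\sum_(j < m) _ * j) => S T D.
rewrite !mul1n !mulnDr -!mulnn -[nat_of_bool true]/1; nia.
Qed.

Lemma square_threshold n p : dis n p ->
  let adj i j := (i < j <= i + nth 0 p i) || (j < i <= j + nth 0 p j) in
  \sum_(i < n.+1) (\sum_(j < n.+1) adj i j) ^ 2 = 2 * weight p /\
  \sum_(i < n.+1) \sum_(j < n.+1) adj i j = 2 * sumn p.
Proof.
move=> dp adj; pose c i j := i < j <= i + nth 0 p i.
have adjE i j : adj i j = c i j + c j i :> nat by rewrite /adj /c; lia.
have row (i : 'I_n.+1) :
    (\sum_(j < n.+1) adj i j) ^ 2 + 2 * \sum_(j < n.+1) c i j =
    \sum_(j < n.+1) adj i j + 2 * \sum_(j < n.+1) adj i j * j.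
  have := @square_initial n.+1 (adj i) i _ _.
  have -> : \sum_(j < n.+1) adj i j * (i < j) = \sum_(j < n.+1) c i j.
    by apply: eq_bigr => j _; rewrite /adj /c; lia.
  apply; first by rewrite /adj; lia.
  move=> x y; rewrite /adj => /orP[] h xy xi.
    case: (ltnP i x) => ix; first lia.
    have := @dis_nth_mono n p i x dp ix; lia.
  have := @dis_nth_mono n p y x dp (ltnW xy); lia.
have sc : \sum_(i < n.+1) \sum_(j < n.+1) c i j = sumn p.
  rewrite -size_diag size_map -sum1_size -(sum_cells (fun _ _ => 1) dp).
  by apply: eq_bigr => i _; apply: eq_bigr => j _; rewrite muln1.
have sa : \sum_(i < n.+1) \sum_(j < n.+1) adj i j = 2 * sumn p.
  rewrite -sc mul2n -addnn [X in _ + X]exchange_big -big_split /=.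
  apply: eq_bigr => i _ /=; rewrite -big_split /=.
  by apply: eq_bigr => j _; rewrite /= adjE.
(* Summing [row] over all vertices, the neighbours beyond [i] count each edge once, and the labels
   of neighbours add up to s + t over the edges, which is the weight. *)
split=> //; apply: (@addIn (2 * sumn p)).
rewrite -{1}sc big_distrr -big_split /=; under eq_bigr do rewrite row.
rewrite big_split /=.
rewrite sa -big_distrr /= addnC; congr (2 * _ + _).
have -> : weight p = \sum_(st <- cells p) (st.1 + st.2).
  by rewrite /weight /diag sumnE big_map.
rewrite -(sum_cells addn dp).
transitivity (\sum_(i < n.+1) \sum_(j < n.+1) c i j * j +
              \sum_(i < n.+1) \sum_(j < n.+1) c i j * i).
  rewrite [X in _ + X]exchange_big -big_split /=; apply: eq_bigr => i _.
  by rewrite /= -big_split /=; apply: eq_bigr => j _ /=; rewrite adjE mulnDl.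
rewrite -big_split /=; apply: eq_bigr => i _ /=; rewrite -big_split /=.
by apply: eq_bigr => j _ /=; rewrite /c; lia.
Qed.

(** * Degrees and adjacency in edge sets *)

Lemma graphsP v e (E : {set {set 'I_v}}) :
  reflect ((forall A, A \in E -> #|A| = 2) /\ #|E| = e) (E \in graphs v e).
Proof.
rewrite inE; apply: (iffP andP) => -[h1 h2]; split; try exact/eqP.
  by move=> A AE; apply/eqP; apply: (forall_inP h1).
by apply/forall_inP => A /h1 ->.
Qed.

Lemma set2_inj (T : finType) (i x y : T) : [set i; x] = [set i; y] -> x = y.
Proof.
move=> e; have : x \in [set i; y] by rewrite -e set22.
rewrite !inE => /orP[/eqP xi|/eqP //]; subst x.
by move/setP/(_ y): e; rewrite !inE eqxx orbT orbb eq_sym => /eqP.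
Qed.

Lemma degree_sum v (E : {set {set 'I_v}}) i :
  degree E i = \sum_(A in E) (i \in A).
Proof.
rewrite /degree -sum1_card [RHS]big_mkcond [LHS]big_mkcond /=.
by apply: eq_bigr => A _; rewrite inE; case: (A \in E); case: (i \in A).
Qed.

Lemma degree_adj v e (E : {set {set 'I_v}}) i : E \in graphs v e ->
  degree E i = \sum_(j < v) ([set i; j] \in E).
Proof.
case/graphsP => card2 _.
have -> : degree E i = #|[set j | [set i; j] \in E]|.
  rewrite -(card_imset _ (@set2_inj _ i)) /degree; apply: eq_card => A.
  rewrite inE; apply/andP/imsetP => [[AE iA]|[j]]; last first.
    by rewrite inE => jE ->; rewrite jE set21.
  have /eqP/cards2P[x [y [xy eA]]] := card2 _ AE; subst A.
  move: iA; rewrite !inE => /orP[]/eqP ->; [exists y | exists x] => //;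
    by rewrite ?inE // setUC.
rewrite -sum1_card big_mkcond; apply: eq_bigr => j _; rewrite inE.
by case: (_ \in _).
Qed.

Lemma handshake v e (E : {set {set 'I_v}}) : E \in graphs v e ->
  \sum_(i < v) degree E i = 2 * e.
Proof.
case/graphsP => card2 <-; rewrite (eq_bigr _ (fun i _ => degree_sum E i)).
rewrite exchange_big /= -sum1_card big_distrr /=; apply: eq_bigr => A AE.
by rewrite muln1 -(card2 _ AE) -sum1_card [RHS]big_mkcond.
Qed.

Lemma mem_Th v p (i j : 'I_v) :
  ([set i; j] \in Th v p) =
  (i < j <= i + nth 0 p i) || (j < i <= j + nth 0 p j).
Proof.
rewrite -!mem_cells; apply/imsetP/idP => [[[x y]]|]; rewrite ?inE /=.
  move=> hc e; have xy : x != y.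
    by apply: contraTneq hc => ->; rewrite mem_cells ltnn.
  have /setP ee := e; have := ee x; have := ee y; rewrite !inE !eqxx !orbT /=.
  move=> /orP[]/eqP h1 /orP[]/eqP h2; subst; rewrite ?hc ?orbT //;
    by rewrite eqxx in xy.
by case/orP => h; [exists (i, j) | exists (j, i)]; rewrite ?inE //= setUC.
Qed.

Lemma Th_card2 v p (A : {set 'I_v}) : A \in Th v p -> #|A| = 2.
Proof.
case/imsetP => -[x y]; rewrite inE mem_cells /= => h ->; rewrite cards2.
by case: eqVneq h => // ->; rewrite ltnn.
Qed.

Lemma Th_graph n p : dis n p -> Th n.+1 p \in graphs n.+1 (sumn p).
Proof.
move=> dp; have h0 : Th n.+1 p \in graphs n.+1 #|Th n.+1 p|.
  by apply/graphsP; split=> // A; apply: Th_card2.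
suff <- : #|Th n.+1 p| = sumn p by [].
have := handshake h0; rewrite (eq_bigr _ (fun i _ => degree_adj i h0)).
have [_] := square_threshold dp.
under [in X in _ -> X -> _]eq_bigr do under eq_bigr do rewrite mem_Th.
by move=> /= -> /eqP; rewrite eqn_pmul2l // => /eqP.
Qed.

Lemma P2_Th n p : dis n p -> P2 (Th n.+1 p) = 2 * weight p.
Proof.
move=> dp; have [<- _] := square_threshold dp.
apply: eq_bigr => i _; rewrite (degree_adj _ (Th_graph dp)).
by congr (_ ^ 2); apply: eq_bigr => j _; rewrite mem_Th.
Qed.

(** * Shifted graphs are threshold graphs *)

Lemma decreasing_partition n (f : nat -> nat) : f 0 <= n ->
  (forall i, 0 < f i.+1 -> f i.+1 < f i) ->
  exists2 p, dis n p & forall i, nth 0 p i = f i.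
Proof.
elim: n f => [|n IH] f f0 fd.
  exists [::] => // i; rewrite nth_nil.
  elim: i => [|i IHi]; first by lia.
  by have := fd i; rewrite -IHi; lia.
case: (posnP (f 0)) => f00.
  exists [::] => // i; rewrite nth_nil.
  elim: i => [|i IHi]; first by lia.
  by have := fd i; rewrite -IHi; lia.
have le1 : f 1 <= n by case: (posnP (f 1)) => [->|/fd]; lia.
have [p dp pf] := IH (fun i => f i.+1) le1 (fun i => fd i.+1).
exists (f 0 :: p); last by case.
rewrite dis_cons f00 f0 /=.
case: p dp pf => // b p; rewrite !dis_cons => /andP[hb ->] pf.
by move: (pf 0) (fd 0) => /= <-; lia.
Qed.

Definition shifted v (E : {set {set 'I_v}}) := forall x y z : 'I_v,
  x < y -> [set y; z] \in E -> x != z -> [set x; z] \in E.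

(** The neighbours of [i] beyond [i] form an interval starting at i + 1, and they are also
    neighbours of every smaller vertex. So the interval lengths [f i] strictly decrease while
    positive, and are the parts. *)
Lemma shifted_Th n e (E : {set {set 'I_n.+1}}) : E \in graphs n.+1 e ->
  shifted E -> exists2 p, dis n p & E = Th n.+1 p.
Proof.
case/graphsP => card2 _ sE.
(* [inord] takes its default value only for i > n, where [i < j] is false. *)
pose nb i (j : 'I_n.+1) := (i < j) && ([set inord i; j] \in E).
pose f i := \max_(j < n.+1 | nb i j) (j - i).
have fmax i : 0 < f i -> exists2 j, nb i j & f i = j - i.
  move=> fi; have ne : 0 < #|[pred j | nb i j]|.
    rewrite lt0n; apply: contraTneq fi => /card0_eq e0.
    by rewrite /f big1 // => j nj; have := e0 j; rewrite inE /= nj.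
  have [j nj ej] := eq_bigmax_cond (fun j : 'I_n.+1 => j - i) ne.
  by exists j => //; rewrite -ej.
have fge i j : nb i j -> j - i <= f i by move=> h; apply: leq_bigmax_cond.
have nbS i j : nb i.+1 j -> nb i j.
  case/andP => ij jE; have jn := ltn_ord j; rewrite /nb ltnW //=.
  have vi : (inord i : 'I_n.+1) = i :> nat by rewrite inordK //; lia.
  apply: (sE _ (inord i.+1)) => //; first by rewrite vi inordK //; lia.
  by rewrite -val_eqE /= vi; lia.
have nb_down i (j x : 'I_n.+1) : nb i j -> i < x < j -> nb i x.
  case/andP => ij jE /andP[ix xj]; rewrite /nb ix /= setUC; have jn := ltn_ord j.
  rewrite setUC in jE; apply: (sE _ _ _ xj jE); rewrite -val_eqE /= inordK; lia.
have [||p dp pf] := @decreasing_partition n f.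
- by case: (posnP (f 0)) => [->|/fmax[j _ ->]] //; have := ltn_ord j; lia.
- move=> i /fmax[j nj ->]; have := fge _ _ (nbS _ _ nj); case/andP: nj; lia.
exists p => //; have nbE (i j : 'I_n.+1) :
    i < j -> ([set i; j] \in E) = (i < j <= i + nth 0 p i).
  move=> ij; rewrite pf ij /=; have <- : nb i j = ([set i; j] \in E).
    by rewrite /nb ij inord_val.
  apply/idP/idP => [/fge|h]; first lia.
  have [k nk ek] := fmax i ltac:(lia).
  case: (ltngtP j k) => jk; [apply: nb_down nk _ | | rewrite (val_inj jk)//]; lia.
apply/setP => A; apply/idP/idP => AE.
  have /eqP/cards2P[x [y [xy eA]]] := card2 _ AE; subst A.
  rewrite mem_Th; case: (ltngtP x y) => h; last by rewrite (val_inj h) eqxx in xy.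
    by have := nbE _ _ h; rewrite AE h /= => <-.
  by have := nbE _ _ h; rewrite setUC AE h /= => <-.
have /eqP/cards2P[x [y [xy eA]]] := Th_card2 AE; subst A.
move: AE; rewrite mem_Th => /orP[] h.
  by rewrite nbE //; case/andP: h.
by rewrite setUC nbE //; case/andP: h.
Qed.

(** * Graphs of maximal [P2] *)

Definition P2max v e (E : {set {set 'I_v}}) :=
  E \in graphs v e /\ forall E', E' \in graphs v e -> P2 E' <= P2 E.

(** Otherwise replacing the edge yz by xz raises [P2] by 2(deg x - deg y) + 2 > 0. Equal degrees
    suffice, so ties in the sorting by degree do no harm. *)
Lemma P2max_swap v e (E : {set {set 'I_v}}) (x y z : 'I_v) : P2max e E ->
  x != y -> x != z -> degree E y <= degree E x ->
  [set y; z] \in E -> [set x; z] \in E.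
Proof.
move=> [gE maxE] xy xz dxy yzE; apply: contraT => xzE.
have /graphsP[card2 cE] := gE.
have yz : y != z by move: (card2 _ yzE); rewrite cards2; case: eqVneq.
pose F := [set x; z] |: E :\ [set y; z].
have xzF : [set x; z] \notin E :\ [set y; z].
  by rewrite inE negb_and (negbTE xzE) orbT.
have gF : F \in graphs v e.
  apply/graphsP; split=> [A|].
    by rewrite !inE => /orP[/eqP ->|/andP[_ /card2 //]]; rewrite cards2 xz.
  by rewrite cardsU1 xzF; move: cE; rewrite (cardsD1 [set y; z]) yzE.
have dF i : degree F i + (i \in [set y; z]) = degree E i + (i \in [set x; z]).
  rewrite !degree_sum big_setU1 //= [in RHS](big_setD1 _ yzE) /=.
  by move: (\sum_(_ in _) _) => S; rewrite addnC addnA [RHS]addnC addnCA addnA.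
have dx : degree F x = (degree E x).+1.
  by move: (dF x); rewrite !inE eqxx (negbTE xy) (negbTE xz) /=; lia.
have dy : (degree F y).+1 = degree E y.
  move: (dF y); rewrite !inE eqxx (negbTE yz) eq_sym (negbTE xy) /=; lia.
have := maxE _ gF; rewrite /P2 leqNgt => /negP[].
rewrite (bigD1 x) // (bigD1 y) 1?eq_sym // [X in _ < X](bigD1 x) //.
rewrite [X in _ < _ + X](bigD1 y) 1?eq_sym //=.
rewrite [X in _ < _ + (_ + X)](eq_bigr (fun i => degree E i ^ 2)) => [|i /andP[ix iy]].
  rewrite dx -dy -!mulnn; move: dxy; rewrite -dy; move: (\sum_(_ < _ | _) _).
  by move: (degree E x) (degree F y) => a b S ab; nia.
congr (_ ^ 2); apply: (@addIn (i == z)); move: (dF i).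
by rewrite !inE (negbTE ix) (negbTE iy).
Qed.

Definition relabel v (s : {perm 'I_v}) (E : {set {set 'I_v}}) :=
  [set A : {set 'I_v} | [set s x | x in A] \in E].

Lemma relabel_graph v e (s : {perm 'I_v}) (E : {set {set 'I_v}}) :
  E \in graphs v e -> relabel s E \in graphs v e.
Proof.
case/graphsP => card2 cE; apply/graphsP; split=> [A|].
  by rewrite inE => /card2; rewrite card_imset //; apply: perm_inj.
rewrite -cE -(card_imset _ (imset_inj (@perm_inj _ s))); apply: eq_card => A.
apply/imsetP/idP => [[B]|AE]; first by rewrite inE => BE ->.
have eA : A = [set s x | x in [set (s^-1)%g x | x in A]].
  by rewrite -imset_comp -[LHS]imset_id; apply: eq_imset => x /=; rewrite permKV.
by exists [set (s^-1)%g x | x in A]; rewrite // inE -eA.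
Qed.

Lemma relabel_degree v e (s : {perm 'I_v}) (E : {set {set 'I_v}}) i :
  E \in graphs v e -> degree (relabel s E) i = degree E (s i).
Proof.
move=> gE; rewrite (degree_adj _ (relabel_graph s gE)) (degree_adj _ gE).
rewrite [RHS](reindex_inj (@perm_inj _ s)) /=; apply: eq_bigr => j _.
by rewrite inE imsetU1 imset_set1.
Qed.

Lemma relabel_P2 v e (s : {perm 'I_v}) (E : {set {set 'I_v}}) :
  E \in graphs v e -> P2 (relabel s E) = P2 E.
Proof.
move=> gE; rewrite /P2 [RHS](reindex_inj (@perm_inj _ s)) /=.
by apply: eq_bigr => i _; rewrite (relabel_degree _ _ gE).
Qed.

Lemma sorting_perm v (d : 'I_v -> nat) :
  exists s : {perm 'I_v}, forall x y : 'I_v, x < y -> d (s y) <= d (s x).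
Proof.
pose r := relpre d geq; pose l := sort r (enum 'I_v).
have sz : size l == v by rewrite size_sort size_enum_ord.
have inj : injective (tnth (Tuple sz)).
  by apply/tuple_uniqP; rewrite sort_uniq enum_uniq.
exists (perm inj) => x y xy; rewrite !permE !(tnth_nth x) /=.
have tr : transitive r by move=> a b c /= h1 h2; apply: leq_trans h2 h1.
apply: (sorted_ltn_nth tr) xy; rewrite ?inE ?(eqP sz) //.
by apply: sort_sorted => a b /=; apply: leq_total.
Qed.

Lemma max_P2_partition n e (E : {set {set 'I_n.+1}}) : P2max e E ->
  exists p, [/\ dis n p, sumn p = e & P2 E = 2 * weight p].
Proof.
move=> mE; have [gE maxE] := mE.
have [s hs] := sorting_perm (degree E).
have gF := relabel_graph s gE.
have mF : P2max e (relabel s E).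
  by split=> // E' /maxE; rewrite (relabel_P2 _ gE).
have [|p dp eF] := shifted_Th gF.
  move=> x y z xy yzE xz; apply: (P2max_swap mF) yzE => //.
    by rewrite -val_eqE /= ltn_eqF.
  by rewrite !(relabel_degree _ _ gE) hs.
exists p; split=> //; last by rewrite -(P2_Th dp) -eF (relabel_P2 _ gE).
have := handshake gF; rewrite eF (handshake (Th_graph dp)) => /eqP.
by rewrite eqn_pmul2l // => /eqP.
Qed.

(** * From maximal graphs to partitions of maximal weight *)

Lemma max_P2_attained n p : dis n p ->
  exists q, [/\ dis n q, sumn q = sumn p &
    2 * weight q = \max_(E in graphs n.+1 (sumn p)) P2 E].
Proof.
move=> dp; have ne : 0 < #|graphs n.+1 (sumn p)|.
  by apply/card_gt0P; exists (Th n.+1 p); apply: Th_graph.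
have [E gE mE] := eq_bigmax_cond (@P2 n.+1) ne.
have [|q [dq sq wq]] := @max_P2_partition n (sumn p) E.
  by split=> // E' gE'; rewrite -mE; apply: leq_bigmax_cond.
by exists q; split=> //; rewrite mE.
Qed.

Lemma optimalP n e p : optimal n.+1 e p <-> optp n p /\ sumn p = e.
Proof.
rewrite /optimal is_DisE; split=> [[/andP[dp /eqP <-] mx]|[[dp hp] <-]].
  split=> //; split=> // q dq sq; rewrite -(leq_pmul2l (m := 2)) //.
  rewrite -!(@P2_Th n) // mx.
  by apply: leq_bigmax_cond; rewrite -sq Th_graph.
have [q [dq sq wq]] := max_P2_attained dp.
split; first by rewrite dp eqxx.
apply/eqP; rewrite eqn_leq leq_bigmax_cond ?Th_graph //=.
by rewrite -wq (P2_Th dp) leq_pmul2l // hp.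
Qed.

Lemma optp_exists n p : dis n p -> exists2 q, optp n q & sumn q = sumn p.
Proof.
move=> dp; have [q [dq sq wq]] := max_P2_attained dp; exists q => //.
suff /optimalP[] : optimal n.+1 (sumn p) q by [].
by rewrite /optimal is_DisE dq sq eqxx (@P2_Th n).
Qed.

(** * The listed partitions for given parameters *)

Lemma bin2_double k : 2 * 'C(k.+1, 2) = k * k.+1.
Proof. by elim: k => // k IH; rewrite binS bin1; lia. Qed.

Lemma qc_sum e k j : qc_params e k j -> sumn (pi21 k j) = e.
Proof. by move=> [/sum_pi21 h h2]; have := bin2_double k; lia. Qed.

Lemma qc_bound n e k j : e <= 'C(n.+1, 2) -> qc_params e k j ->
  k <= n \/ k = n.+1 /\ j = n.+1.
Proof.
move=> he [hj h]; have hk : k <= n.+1.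
  case: leqP => // nk; have := leq_bin2l 2 nk.
  move: h; rewrite binS bin1 (binS n.+1) bin1; lia.
move: hk; rewrite leq_eqVlt => /orP[/eqP kn|]; last by left; lia.
by right; subst k; move: h; rewrite binS bin1; lia.
Qed.

Lemma qc_dis_pi21 n e k j : e <= 'C(n.+1, 2) -> qc_params e k j ->
  dis n (pi21 k j).
Proof.
move=> he h; case: (qc_bound he h) => [|[-> ->]]; first exact: dis_pi21.
by rewrite pi21_diag dis_down.
Qed.

Lemma quasi_completeP n p : quasi_complete n p -> exists k j,
  [/\ qc_params (sumn p) k j,
      p = pi21 k j \/ (pi22_exists n.+1 k j /\ p = pi22 k j) \/
        (pi23_exists n.+1 j /\ p = pi23 k)
    & perm_eq (diag p) (diag (pi21 k j))].
Proof.
case=> k [j [hj H]]; exists k, j; have h : perm_eq (diag p) (diag (pi21 k j)).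
  case: H => [-> //|[[+ ->]|[+ ->]]].
    by rewrite /pi22_exists => ?; apply: diag_pi22; lia.
  by move=> /andP[/eqP j3 _]; rewrite j3 in hj *; apply: diag_pi23; lia.
split=> //; split=> //; rewrite (perm_sum h).
by have := sum_pi21 hj; have := bin2_double k; lia.
Qed.

Lemma optp_pi21 n p k j : optp n p -> quasi_complete n p ->
  dis n (pi21 k j) -> qc_params (sumn p) k j -> optp n (pi21 k j).
Proof.
move=> ho /quasi_completeP[k1 [j1 [q1 _ h]]] d q2.
have [e1 e2] := qc_unique q1 q2; subst k1 j1.
by apply: (optp_eq ho) => //; rewrite ?(perm_sum h) ?(perm_weight h).
Qed.

Lemma optp_perm n p q : optp n p -> dis n q -> perm_eq (diag q) (diag p) ->
  optp n q.
Proof.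
by move=> ho dq h; apply: (optp_eq ho) => //; [apply: perm_sum|apply: perm_weight].
Qed.

Lemma pi22_perm n k j : 0 < j -> pi22_exists n.+1 k j ->
  dis n (pi22 k j) /\ perm_eq (diag (pi22 k j)) (diag (pi21 k j)).
Proof.
rewrite /pi22_exists => j0 h; split; last by apply: diag_pi22; lia.
by rewrite /pi22 dis_cons dis_down ?andbT //; lia.
Qed.

Lemma pi23_perm n k j : 0 < j <= k -> k <= n \/ k = n.+1 /\ j = n.+1 ->
  pi23_exists n.+1 j ->
  dis n (pi23 k) /\ perm_eq (diag (pi23 k)) (diag (pi21 k j)).
Proof.
move=> hj hk /andP[/eqP j3 n3]; subst j.
by split; [apply: dis_pi23 | apply: diag_pi23]; lia.
Qed.

Lemma pi12_perm n k j : 0 < j -> pi12_exists n.+1 k j ->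
  dis n (pi12 n.+1 k j) /\
  perm_eq (diag (pi12 n.+1 k j)) (diag (pi11 n.+1 k j)).
Proof.
move=> j0 h; split; last exact: diag_pi12.
by rewrite -compl_pi22 ?dis_compl.
Qed.

Lemma pi13_perm n k j : 0 < j <= k -> k <= n \/ k = n.+1 /\ j = n.+1 ->
  pi13_exists n.+1 j ->
  dis n (pi13 n.+1 k) /\ perm_eq (diag (pi13 n.+1 k)) (diag (pi11 n.+1 k j)).
Proof.
move=> hj hk /andP[/eqP j3 n3]; subst j.
split; last by apply: diag_pi13; lia.
by rewrite -compl_pi23 ?dis_compl; lia.
Qed.

Lemma quasi_star_cases n p k j :
  0 < j <= k -> k <= n \/ k = n.+1 /\ j = n.+1 -> dis n p ->
  compl n p = pi21 k j \/ (pi22_exists n.+1 k j /\ compl n p = pi22 k j) \/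
    (pi23_exists n.+1 j /\ compl n p = pi23 k) ->
  p = pi11 n.+1 k j \/ (pi12_exists n.+1 k j /\ p = pi12 n.+1 k j) \/
    (pi13_exists n.+1 j /\ p = pi13 n.+1 k).
Proof.
move=> hj hk /complK e H; have [j0 _] := andP hj.
case: H e => [->|[[h ->]|[h ->]]] <-; first by left; apply: compl_pi21.
  by right; left; rewrite compl_pi22.
right; right; split=> //; have [/eqP j3 n3] := andP h.
by apply: compl_pi23; lia.
Qed.

Theorem theorem2 (v e : nat) (hv : 0 < v) (he : e <= 'C(v, 2)) :
  (exists! kj : nat * nat, qc_params e kj.1 kj.2) /\
  (exists! kj' : nat * nat, qs_params v e kj'.1 kj'.2) /\
  (forall k j k' j' : nat, qc_params e k j -> qs_params v e k' j' ->
    (forall pi : seq nat, optimal v e pi ->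
      pi = pi11 v k' j' \/
      (pi12_exists v k' j' /\ pi = pi12 v k' j') \/
      (pi13_exists v j' /\ pi = pi13 v k') \/
      pi = pi21 k j \/
      (pi22_exists v k j /\ pi = pi22 k j) \/
      (pi23_exists v j /\ pi = pi23 k)) /\
    is_Dis v e (pi11 v k' j') /\
    is_Dis v e (pi21 k j) /\
    (optimal v e (pi11 v k' j') \/ optimal v e (pi21 k j)) /\
    (pi12_exists v k' j' ->
      is_Dis v e (pi12 v k' j') /\
      diagonal_sequence (pi12 v k' j') = diagonal_sequence (pi11 v k' j')) /\
    (pi13_exists v j' ->
      is_Dis v e (pi13 v k') /\
      diagonal_sequence (pi13 v k') = diagonal_sequence (pi11 v k' j')) /\
    (quasi_complete_P2 v k j <= quasi_star_P2 v k' j' ->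
      optimal v e (pi11 v k' j') /\
      (pi12_exists v k' j' -> optimal v e (pi12 v k' j')) /\
      (pi13_exists v j' -> optimal v e (pi13 v k'))) /\
    (pi22_exists v k j ->
      is_Dis v e (pi22 k j) /\
      diagonal_sequence (pi22 k j) = diagonal_sequence (pi21 k j)) /\
    (pi23_exists v j ->
      is_Dis v e (pi23 k) /\
      diagonal_sequence (pi23 k) = diagonal_sequence (pi21 k j)) /\
    (quasi_star_P2 v k' j' <= quasi_complete_P2 v k j ->
      optimal v e (pi21 k j) /\
      (pi22_exists v k j -> optimal v e (pi22 k j)) /\
      (pi23_exists v j -> optimal v e (pi23 k)))).
Proof.
case: v hv he => // n _ he.
split.
  have [k [j h]] := qc_exists e; exists (k, j); split=> // -[k1 j1] /= h1.
  by have [-> ->] := qc_unique h h1.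
split.
  have [k [j h]] := qc_exists ('C(n.+1, 2) - e).
  exists (k, j); split=> [|[k1 j1]] /=; rewrite qs_qc // => h1.
  by have [-> ->] := qc_unique h h1.
(* The star parameters become the quasi-complete parameters of the complementary edge number
   [e']. *)
move=> k j k' j' hq; rewrite qs_qc //; set e' := _ - e => hq'.
have he' : e' <= 'C(n.+1, 2) by apply: leq_subr.
have [hj _] := hq; have [hj' _] := hq'.
have d21 := qc_dis_pi21 he hq; have d21' := qc_dis_pi21 he' hq'.
have s21 := qc_sum hq; have s21' := qc_sum hq'.
have c11 := compl_pi21 hj' (qc_bound he' hq').
have scompl p : dis n p -> sumn (compl n p) + sumn p = 'C(n.+1, 2).
  by move=> dp; have := sum_compl dp; have := bin2_double n; lia.
have d11 : dis n (pi11 n.+1 k' j') by rewrite -c11 dis_compl.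
have s11 : sumn (pi11 n.+1 k' j') = e.
  by rewrite -c11 -(addnK (sumn (pi21 k' j')) (sumn _)) scompl // s21' subKn.
(* Some optimal partition exists. It or its complement is quasi-complete, and uniqueness of the
   parameters gives it the weight of the matching [pi21]. *)
have best : optp n (pi11 n.+1 k' j') \/ optp n (pi21 k j).
  have [p ho sp] := optp_exists d21; rewrite s21 in sp.
  have [dp _] := ho; case: (optp_quasi ho) => hp.
    by right; apply: optp_pi21 ho hp _ _; rewrite // sp.
  left; rewrite -c11; apply/optp_compl/(optp_pi21 (optp_compl ho)) => //.
  by rewrite -(addnK (sumn p) (sumn _)) scompl // sp.
have [j0 _] := andP hj; have [j0' _] := andP hj'.
have x12 := @pi12_perm n k' j' j0'.
have x13 := @pi13_perm n k' j' hj' (qc_bound he' hq').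
have x22 := @pi22_perm n k j j0.
have x23 := @pi23_perm n k j hj (qc_bound he hq).
have P11 : quasi_star_P2 n.+1 k' j' = 2 * weight (pi11 n.+1 k' j').
  exact: (@P2_Th n).
have P21 : quasi_complete_P2 n.+1 k j = 2 * weight (pi21 k j).
  exact: (@P2_Th n).
have opt_of p : optp n p -> sumn p = e -> optimal n.+1 e p.
  by move=> ? ?; apply/optimalP.
have is_Dis_of p q : dis n p -> perm_eq (diag p) (diag q) -> sumn q = e ->
    is_Dis n.+1 e p.
  by move=> dp h sq; rewrite is_DisE dp (perm_sum h) sq eqxx.
have pos p q : optp n p -> sumn p = e -> dis n q -> perm_eq (diag q) (diag p) ->
    optimal n.+1 e q.
  move=> ho sp dq h; apply: opt_of; first exact: optp_perm h.
  by rewrite (perm_sum h).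
split; last split; last split; last split; last split; last split; last split;
  last split; last split.
- move=> p /optimalP[ho sp]; have [dp _] := ho.
  case: (optp_quasi ho) => /quasi_completeP[k1 [j1 [q1 H _]]].
    rewrite sp in q1; have [e1 e2] := qc_unique q1 hq; subst k1 j1.
    by right; right; right.
  have sp' : sumn (compl n p) = e' by rewrite /e' -(scompl _ dp) sp addnK.
  rewrite sp' in q1; have [e1 e2] := qc_unique q1 hq'; subst k1 j1.
  by case: (quasi_star_cases hj' (qc_bound he' hq') dp H); tauto.
- by rewrite is_DisE d11 s11 eqxx.
- by rewrite is_DisE d21 s21 eqxx.
- by case: best => ho; [left | right]; apply: opt_of.
- move=> /x12[d h]; split; first exact: is_Dis_of h s11.
  exact: perm_diagonal_sequence.
- move=> /x13[d h]; split; first exact: is_Dis_of h s11.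
  exact: perm_diagonal_sequence.
- rewrite P11 P21 leq_pmul2l // => le.
  have ho : optp n (pi11 n.+1 k' j').
    (* If [pi21] is the optimal one, the assumed inequality forces equal weights. *)
    case: best => // ho; apply: (optp_eq ho); rewrite ?s21 //.
    by apply/eqP; rewrite eqn_leq le (proj2 ho) // s21.
  split; first exact: opt_of.
  by split=> [/x12[d h]|/x13[d h]]; apply: pos h.
- move=> /x22[d h]; split; first exact: is_Dis_of h s21.
  exact: perm_diagonal_sequence.
- move=> /x23[d h]; split; first exact: is_Dis_of h s21.
  exact: perm_diagonal_sequence.
- rewrite P11 P21 leq_pmul2l // => le.
  have ho : optp n (pi21 k j).
    case: best => // ho; apply: (optp_eq ho); rewrite ?s11 //.
    by apply/eqP; rewrite eqn_leq le (proj2 ho) // s11.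
  split; first exact: opt_of.
  by split=> [/x22[d h]|/x23[d h]]; apply: pos h.
Qed.
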